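(* Let $n\ge 1$, let $H\in\mathbb{R}^{n\times n}$ be symmetric positive definite, let $h\in\mathbb{R}^n$ with $h\neq 0$, and let $\epsilon>0$. Let $\eta=\frac{\sqrt{2}-1}{\sqrt{2n}+\sqrt{2}-1}$, $\tau^0=\frac{1}{1-\eta}$ and $\lambda=\frac{1}{\sqrt{n+1}}$, and let $v_k,s_k\in\mathbb{R}^{2n}$ ($k=0,1,2,\dots$) be the iterates of the full-Newton interior-point algorithm described in the context, applied to the box-constrained quadratic program $\min_z \frac12 z^\top Hz+z^\top h$ subject to $-e\le z\le e$. Then the algorithm requires at most $$N_{\max}=\left\lceil\frac{\log\left(\frac{2n}{\epsilon}\right)}{-2\log\left(\frac{\sqrt{2n}}{\sqrt{2n}+\sqrt{2}-1}\right)}\right\rceil+1$$ iterations to reach $v^\top s\le\epsilon$; that is, there is an integer $k$ with $0\le k\le\max(N_{\max},0)$ such that $v_k^\top s_k\le\epsilon$.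
   Context: Products, quotients and square roots of vectors are componentwise; $e$ is the all-ones vector; $\|\cdot\|_\infty$ is the max norm; $\mathrm{diag}(x)$ is the diagonal matrix with diagonal $x$; $\mathrm{col}(x,y)$ stacks $x$ on top of $y$. Algorithm. Set $\tilde H=\frac{1}{\|h\|_\infty}H$ and $\tilde h=\frac{1}{\|h\|_\infty}h$. Initialize $z_0=0$, $\gamma_0=e-\lambda\tilde h$, $\theta_0=e+\lambda\tilde h$, $\phi_0=e$, $\psi_0=e$ (all in $\mathbb{R}^n$), and $\tau_0=\tau^0$. For $k=1,2,\dots$, iteration $k$ is: set $\tau_k=(1-\eta)\tau_{k-1}$; with $(z,\gamma,\theta,\phi,\psi)=(z_{k-1},\gamma_{k-1},\theta_{k-1},\phi_{k-1},\psi_{k-1})$ and $\tau=\tau_k$, solve $$\left(2\lambda\tilde H+\mathrm{diag}\left(\tfrac{\gamma}{\phi}\right)+\mathrm{diag}\left(\tfrac{\theta}{\psi}\right)\right)\Delta z=2\left(\sqrt{\tfrac{\theta}{\psi}}\,\tau e-\sqrt{\tfrac{\gamma}{\phi}}\,\tau e+\gamma-\theta\right)$$ for $\Delta z$, and put $\Delta\gamma=\frac{\gamma}{\phi}\Delta z+2\left(\sqrt{\frac{\gamma}{\phi}}\,\tau e-\gamma\right)$, $\Delta\theta=-\frac{\theta}{\psi}\Delta z+2\left(\sqrt{\frac{\theta}{\psi}}\,\tau e-\theta\right)$, $\Delta\phi=-\Delta z$, $\Delta\psi=\Delta z$; then $(z_k,\gamma_k,\theta_k,\phi_k,\psi_k)=(z+\Delta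 z,\gamma+\Delta\gamma,\theta+\Delta\theta,\phi+\Delta\phi,\psi+\Delta\psi)$. Finally $v_k=\mathrm{col}(\gamma_k,\theta_k)$ and $s_k=\mathrm{col}(\phi_k,\psi_k)$. The number of iterations required is the number of passes needed to reach $v_k^\top s_k\le\epsilon$. *)

(* Defs.v *)
From mathcomp Require Import all_boot all_order all_algebra.
From mathcomp Require Import all_classical all_reals all_analysis.

Set Implicit Arguments.
Unset Strict Implicit.
Unset Printing Implicit Defensive.

Import Order.TTheory GRing.Theory Num.Theory.
Import numFieldNormedType.Exports.

Local Open Scope ring_scope.

Section BoxQP.
Context {R : realType} {n : nat}.

Definition sym_posdef (H : 'M[R]_n) : Prop :=
  H^T = H /\ forall x : 'cV[R]_n, x != 0 -> 0 < (x^T *m H *m x) 0 0.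

(* Componentwise operations on vectors. *)
Definition vmul (x y : 'cV[R]_n) : 'cV[R]_n := \col_i (x i 0 * y i 0).
Definition vdiv (x y : 'cV[R]_n) : 'cV[R]_n := \col_i (x i 0 / y i 0).
Definition vsqrt (x : 'cV[R]_n) : 'cV[R]_n := \col_i Num.sqrt (x i 0).
Definition ones : 'cV[R]_n := const_mx 1.
Definition diag (x : 'cV[R]_n) : 'M[R]_n := diag_mx x^T.

(* The multipliers gamma, theta belong to the constraints z <= e and -e <= z
   of the problem min 1/2 z^T H z + z^T h, and phi, psi are their slacks;
   tau is the value tau_k used to produce the k-th iterate. *)
Record ipm_state := IpmState {
  ipm_z : 'cV[R]_n;
  ipm_gamma : 'cV[R]_n;
  ipm_theta : 'cV[R]_n;
  ipm_phi : 'cV[R]_n;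
  ipm_psi : 'cV[R]_n;
  ipm_tau : R
}.

Definition newton_mx (lam : R) (Ht : 'M[R]_n)
    (gamma theta phi psi : 'cV[R]_n) : 'M[R]_n :=
  (2 * lam) *: Ht + diag (vdiv gamma phi) + diag (vdiv theta psi).

Definition newton_rhs (gamma theta phi psi : 'cV[R]_n) (tau : R) : 'cV[R]_n :=
  2 *: (vmul (vsqrt (vdiv theta psi)) (tau *: ones)
        - vmul (vsqrt (vdiv gamma phi)) (tau *: ones)
        + gamma - theta).

(* The solution of the linear system newton_mx *m dz = newton_rhs; see
   newton_dzP below. *)
Definition newton_dz (lam : R) (Ht : 'M[R]_n)
    (gamma theta phi psi : 'cV[R]_n) (tau : R) : 'cV[R]_n :=
  invmx (newton_mx lam Ht gamma theta phi psi)
    *m newton_rhs gamma theta phi psi tau.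

Definition ipm_step (lam eta : R) (Ht : 'M[R]_n) (st : ipm_state)
    : ipm_state :=
  let: IpmState z gamma theta phi psi tau_prev := st in
  let tau := (1 - eta) * tau_prev in
  let dz := newton_dz lam Ht gamma theta phi psi tau in
  let dgamma := vmul (vdiv gamma phi) dz
    + 2 *: (vmul (vsqrt (vdiv gamma phi)) (tau *: ones) - gamma) in
  let dtheta := - vmul (vdiv theta psi) dz
    + 2 *: (vmul (vsqrt (vdiv theta psi)) (tau *: ones) - theta) in
  let dphi := - dz in
  let dpsi := dz in
  IpmState (z + dz) (gamma + dgamma) (theta + dtheta)
           (phi + dphi) (psi + dpsi) tau.

Definition ipm_init (lam tau0 : R) (ht : 'cV[R]_n) : ipm_state :=
  IpmState 0 (ones - lam *: ht) (ones + lam *: ht) ones ones tau0.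

(* The norm `|h| of a matrix is the max norm. *)
Definition ipm_iterate (H : 'M[R]_n) (h : 'cV[R]_n) (eta tau0 lam : R)
    (k : nat) : ipm_state :=
  iter k (ipm_step lam eta (`|h|^-1 *: H)) (ipm_init lam tau0 (`|h|^-1 *: h)).

Definition ipm_v (st : ipm_state) : 'cV[R]_(n + n) :=
  col_mx (ipm_gamma st) (ipm_theta st).

Definition ipm_s (st : ipm_state) : 'cV[R]_(n + n) :=
  col_mx (ipm_phi st) (ipm_psi st).

(* At strictly positive gamma, theta, phi, psi the Newton system is uniquely
   solvable, and newton_dz is its solution. *)
Lemma newton_dzP (lam : R) (Ht : 'M[R]_n) (gamma theta phi psi : 'cV[R]_n)
    (tau : R) (dz : 'cV[R]_n) :
  0 < lam -> sym_posdef Ht ->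
  (forall i, [/\ 0 < gamma i 0, 0 < theta i 0, 0 < phi i 0 & 0 < psi i 0]) ->
  newton_mx lam Ht gamma theta phi psi *m dz
    = newton_rhs gamma theta phi psi tau
  <-> dz = newton_dz lam Ht gamma theta phi psi tau.
Proof.
move=> lam0 [Hsym Hpos] pos; set A := newton_mx _ _ _ _ _ _.
have Apos (x : 'cV[R]_n) : x != 0 -> 0 < (x^T *m A *m x) 0 0.
  have diag_ge0 (g p : 'cV[R]_n) : (forall i, 0 < g i 0 /\ 0 < p i 0) ->
      0 <= (x^T *m diag (vdiv g p) *m x) 0 0.
    move=> gp; rewrite mul_mx_diag mxE sumr_ge0// => i _; rewrite !mxE.
    have [g0 p0] := gp i.
    by rewrite mulrAC -expr2 mulr_ge0 ?sqr_ge0// divr_ge0// ltW.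
  move=> x0; rewrite /A /newton_mx !mulmxDr !mulmxDl mxE [X in X + _]mxE.
  rewrite -addrA ltr_wpDr ?addr_ge0 ?diag_ge0//; try by move=> i; case: (pos i).
  by rewrite -scalemxAr -scalemxAl mxE mulr_gt0 ?mulr_gt0 ?Hpos.
have Aunit : A \in unitmx.
  rewrite -unitmx_tr -row_free_unit -kermx_eq0; apply/negPn/negP => /rowV0Pn.
  move=> [u /sub_kermxP uA u0].
  have := Apos u^T; rewrite trmx_eq0 u0 => /(_ isT); rewrite trmxK -mulmxA.
  by rewrite -[A *m _]trmxK trmx_mul trmxK uA trmx0 mulmx0 mxE ltxx.
rewrite /newton_dz -/A.
by split=> [<-|->]; rewrite ?mulKmx ?mulKVmx.
Qed.

End BoxQP.

(* Main.v *)
Require Import Defs.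
From mathcomp Require Import all_boot all_order all_algebra.
From mathcomp Require Import all_classical all_reals all_analysis.
From mathcomp Require Import ring lra.
Import Order.TTheory GRing.Theory Num.Theory.
Import numFieldNormedType.Exports.
Set Implicit Arguments.
Unset Strict Implicit.
Local Open Scope ring_scope.

(** Write [b_i = sqrt (v_i s_i)], [i] ranging over the [2n] stacked
components, and measure the squared distance to the central path at parameter
[tau] by [sum_i (tau - b_i)^2].  The invariant is that, when a step towards [tau]
begins, this quantity is at most [tau^2 / 2] and all components are positive
([near_path]).

The Newton equations linearise [b_i = tau], so the new products are
[tau^2 - r_i] with [r_i = (tau - b_i)^2 - dv_i ds_i].  Each [r_i] is
nonnegative, being a square over [4 v_i s_i], and the [r_i] sum to at most the
old squared distance, because [sum_i dv_i ds_i = 2 lam dz^T Ht dz >= 0].  Three things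
follow from this.
- The duality gap after the step is at most [2n tau^2].
- Every [r_i] is at most [tau^2 / 2], so the products stay positive, and hence
  so do [v] and [s].
- The deviations [a_i = tau - sqrt (tau^2 - r_i)] are nonnegative and
  [sum_i a_i^2 <= tau^2 / 9]: the convergence is quadratic.

The next target is [t = (1 - eta) tau < tau].  The new deviation
[t - sqrt (tau^2 - r_i)] equals [a_i - (tau - t)], a difference of two
nonnegative numbers, so its square is at most [a_i^2 + (tau - t)^2]; the choice
of [eta] makes [2n (tau - t)^2 <= t^2 / 4] and [tau <= 3/2 t], and the two
contributions are at most [t^2 / 4] each.  The plain triangle inequality for
the norm would lose too much here.

At the start [s = e] and [v = e -+ lam ht] with [|ht_i| <= 1]; the choice of
[lam] puts this point within squared distance [1/2] of the target [tau_1 = 1]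
([sqrt_pair_deviation]).  Hence [tau_k = (1 - eta)^(k-1)] and the gap after
[k >= 1] steps is at most [2n (1 - eta)^(2(k-1))]; taking logarithms gives
[Nmax].  If [Nmax <= 0] then [2n <= eps], and the initial point, whose gap is
exactly [2n], is already good enough. *)

(** * One full Newton step on a family of complementarity products *)

(** The correction [r = (tau - b)^2 - dv ds] is the quantity that controls the
whole analysis: it is all that separates the new product from [tau^2]. *)
Lemma newton_complementarity (R : realType) (v s dv ds tau : R) :
  0 <= v * s ->
  s * dv + v * ds = 2 * (tau * Num.sqrt (v * s) - v * s) ->
  (v + dv) * (s + ds)
    = tau ^+ 2 - ((tau - Num.sqrt (v * s)) ^+ 2 - dv * ds).
Proof.
move=> vs0 E; have := sqr_sqrtr vs0; set b := Num.sqrt _ in E * => b2.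
by rewrite -b2 in E; nra.
Qed.

(** Arithmetic-geometric mean for [s dv] and [v ds]: the residual, multiplied by
[v s], is the square of [(s dv - v ds) / 2]. *)
Lemma newton_residual_ge0 (R : realType) (v s dv ds tau : R) :
  0 < v * s ->
  s * dv + v * ds = 2 * (tau * Num.sqrt (v * s) - v * s) ->
  0 <= (tau - Num.sqrt (v * s)) ^+ 2 - dv * ds.
Proof.
move=> vs0 E; rewrite subr_ge0 -(ler_pM2l vs0).
have b2 := sqr_sqrtr (ltW vs0); set b := Num.sqrt _ in E b2 *.
have -> : v * s * (tau - b) ^+ 2 = ((s * dv + v * ds) / 2) ^+ 2.
  by rewrite E -b2; field.
rewrite -subr_ge0.
have -> : ((s * dv + v * ds) / 2) ^+ 2 - v * s * (dv * ds)
    = ((s * dv - v * ds) / 2) ^+ 2 by field.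
exact: sqr_ge0.
Qed.

(** Two numbers with a positive product are both positive as soon as some
positive combination of them is; here [s (v + dv) + v (s + ds)] is
[2 tau sqrt (v s)]. *)
Lemma newton_entries_gt0 (R : realType) (v s dv ds tau : R) :
  0 < tau -> 0 < v -> 0 < s ->
  s * dv + v * ds = 2 * (tau * Num.sqrt (v * s) - v * s) ->
  0 < (v + dv) * (s + ds) -> 0 < v + dv /\ 0 < s + ds.
Proof.
move=> tau0 v0 s0 E prod0.
have b0 : 0 < Num.sqrt (v * s) by rewrite sqrtr_gt0 mulr_gt0.
have sum0 : 0 < s * (v + dv) + v * (s + ds).
  have -> : s * (v + dv) + v * (s + ds) = 2 * (tau * Num.sqrt (v * s)).
    by rewrite !mulrDr; move: E; lra.
  by rewrite !mulr_gt0.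
have [v'0|v'0] := ltP 0 (v + dv); first by rewrite -(pmulr_rgt0 _ v'0).
have s'0 : s + ds <= 0.
  rewrite leNgt; apply/negP => s'0.
  by move: prod0; rewrite pmulr_lgt0 // ltNge v'0.
have := mulr_ge0_le0 (ltW s0) v'0; have := mulr_ge0_le0 (ltW v0) s'0.
by move: sum0; lra.
Qed.

(** From [a (tau + g) = r], where [g = sqrt (tau^2 - r)]: since [g >= tau / 2],
the deviation [a] is at most [2 r / (3 tau)], which is linear in [r] and thus
quadratic in the previous deviation. *)
Lemma sqrt_gap_bounds (R : realType) (tau r : R) :
  0 < tau -> 0 <= r -> r <= tau ^+ 2 / 2 ->
  let a := tau - Num.sqrt (tau ^+ 2 - r) in
  [/\ 0 <= a, 3 * tau * a <= 2 * r & 3 * a <= tau].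
Proof.
move=> tau0 r0 rle a.
have w0 : 0 <= tau ^+ 2 - r by move: (sqr_ge0 tau); lra.
have g0 := sqrtr_ge0 (tau ^+ 2 - r).
have g2 := sqr_sqrtr w0.
rewrite /a; set g := Num.sqrt _ in g0 g2 *.
have gt : g <= tau by rewrite -(ler_pXn2r (n := 2)) ?nnegrE ?(ltW tau0) // g2; lra.
(* [g tau >= g^2 >= tau^2 / 2]: cruder than [g >= tau / sqrt 2], but rational. *)
have tg : tau / 2 <= g.
  rewrite -(ler_pM2l tau0); have := ler_wpM2r g0 gt; rewrite -expr2 g2.
  by move: rle; rewrite expr2; lra.
have key : 3 * tau * (tau - g) <= 2 * r by nra.
split; [lra| exact: key|].
by rewrite -(ler_pM2l tau0); move: rle key; rewrite expr2; lra.
Qed.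

(** The neighbourhood of the central path in which one full Newton step towards
[t] converges quadratically.  A relative Euclidean distance below 1 already
keeps the step feasible; the radius [1 / sqrt 2] leaves room for shrinking the
parameter. *)
Definition near_path (R : realType) (I : finType) (t : R) (v s : I -> R) :=
  (forall i, 0 < v i /\ 0 < s i) /\
  \sum_i (t - Num.sqrt (v i * s i)) ^+ 2 <= t ^+ 2 / 2.

(** The step aims at [tau], and its result is measured against the next, smaller
target [t].  The bounds relating [t] and [tau] are what the choice of [eta] has
to provide. *)
Lemma near_path_newton (R : realType) (I : finType) (v s dv ds : I -> R)
    (tau t : R) :
  0 < t -> t <= tau -> tau <= 3 / 2 * t ->
  #|I|%:R * (tau - t) ^+ 2 <= t ^+ 2 / 4 ->
  near_path tau v s ->
  (forall i, s i * dv i + v i * ds i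
             = 2 * (tau * Num.sqrt (v i * s i) - v i * s i)) ->
  0 <= \sum_i dv i * ds i ->
  near_path t (fun i => v i + dv i) (fun i => s i + ds i) /\
  \sum_i (v i + dv i) * (s i + ds i) <= #|I|%:R * tau ^+ 2.
Proof.
move=> t0 ttau tautle card_le [pos near] newton dvds.
have tau0 : 0 < tau := lt_le_trans t0 ttau.
have vs0 i : 0 < v i * s i by have [? ?] := pos i; rewrite mulr_gt0.
pose r i := (tau - Num.sqrt (v i * s i)) ^+ 2 - dv i * ds i.
have r0 i : 0 <= r i by apply: newton_residual_ge0.
have prodE i : (v i + dv i) * (s i + ds i) = tau ^+ 2 - r i.
  by apply: newton_complementarity => //; apply: ltW.
have sumr : \sum_i r i <= tau ^+ 2 / 2.
  by rewrite sumrB (le_trans _ near) // lerBlDr lerDl.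
have rle i : r i <= tau ^+ 2 / 2.
  by apply: le_trans sumr; rewrite (bigD1 i) //= lerDl sumr_ge0.
have prod0 i : 0 < (v i + dv i) * (s i + ds i).
  by rewrite prodE; have := exprn_gt0 2 tau0; have := rle i; lra.
pose a i := tau - Num.sqrt (tau ^+ 2 - r i).
have aP i := sqrt_gap_bounds tau0 (r0 i) (rle i).
have suma : \sum_i a i ^+ 2 <= tau ^+ 2 / 9.
  apply: (@le_trans _ _ (\sum_i 2 / 9 * r i)).
    apply: ler_sum => i _; have [a0 ar at_] := aP i; rewrite -/(a i) in a0 ar at_.
    by have := ler_wpM2r a0 at_; rewrite expr2; lra.
  by rewrite -mulr_sumr; lra.
have sum_cst (c : R) : \sum_(i : I) c = #|I|%:R * c.
  by rewrite sumr_const mulr_natl.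
split; last first.
  rewrite (eq_bigr _ (fun i _ => prodE i)) sumrB sum_cst.
  by rewrite lerBlDr lerDl sumr_ge0.
split=> [i|].
  by have [v0 s0] := pos i; apply: newton_entries_gt0 (newton i) (prod0 i).
apply: (@le_trans _ _ (\sum_i (a i ^+ 2 + (tau - t) ^+ 2))).
  apply: ler_sum => i _; rewrite prodE.
  have -> : t - Num.sqrt (tau ^+ 2 - r i) = a i - (tau - t).
    by rewrite /a; lra.
  have [a0 _ _] := aP i; rewrite -/(a i) in a0.
  (* Both terms of the difference are nonnegative, so the cross term helps. *)
  have : 0 <= a i * (tau - t) by rewrite mulr_ge0 // subr_ge0.
  by rewrite sqrrB; lra.
rewrite big_split /= sum_cst.
have : tau ^+ 2 <= (3 / 2 * t) ^+ 2.
  by rewrite ler_pXn2r // nnegrE; lra.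
by rewrite exprMn; lra.
Qed.

(** * The Newton step of the algorithm *)

(** The update formulas of the algorithm, freed from division by the slack.  The
same identity serves both blocks, with [d = dz] for [(gamma, phi)] and
[d = - dz] for [(theta, psi)]. *)
Lemma newton_component (R : realType) (g p d tau : R) : 0 < g -> 0 < p ->
  p * (g / p * d + 2 * (Num.sqrt (g / p) * tau - g)) + g * - d
    = 2 * (tau * Num.sqrt (g * p) - g * p).
Proof.
move=> g0 p0.
have -> : Num.sqrt (g * p) = Num.sqrt (g / p) * p.
  have -> : g * p = g / p * p ^+ 2 by field; rewrite gt_eqF.
  by rewrite sqrtrM ?divr_ge0 ?ltW // sqrtr_sqr gtr0_norm.
by field; rewrite gt_eqF.
Qed.

Lemma mul_diag_vmul (R : realType) (n : nat) (x y : 'cV[R]_n) :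
  diag x *m y = vmul x y.
Proof.
by apply/matrixP => i j; rewrite mul_diag_mx !mxE (ord1 j).
Qed.

Definition ipm_near (R : realType) (n : nat) (t : R) (st : @ipm_state R n) :=
  near_path t (fun i => ipm_v st i 0) (fun i => ipm_s st i 0).

Definition duality_gap (R : realType) (n : nat) (st : @ipm_state R n) : R :=
  ((ipm_v st)^T *m ipm_s st) 0 0.

Lemma duality_gapE (R : realType) (n : nat) (st : @ipm_state R n) :
  duality_gap st = \sum_i ipm_v st i 0 * ipm_s st i 0.
Proof. by rewrite /duality_gap mxE; apply: eq_bigr => i _; rewrite mxE. Qed.

(** Besides the componentwise equations, the linear system encodes dual
feasibility of the step, [dth - dg = 2 lam Ht dz]; positive definiteness then
gives [dv^T ds = 2 lam dz^T Ht dz >= 0]. *)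
Lemma ipm_step_near (R : realType) (n : nat) (lam eta t : R) (Ht : 'M[R]_n)
    (st : @ipm_state R n) :
  0 < lam -> sym_posdef Ht ->
  let tau := (1 - eta) * ipm_tau st in
  0 < t -> t <= tau -> tau <= 3 / 2 * t ->
  (n + n)%:R * (tau - t) ^+ 2 <= t ^+ 2 / 4 ->
  ipm_near tau st ->
  ipm_near t (ipm_step lam eta Ht st) /\
  duality_gap (ipm_step lam eta Ht st) <= (n + n)%:R * tau ^+ 2.
Proof.
move=> lam0 Hpd; case: st => z g th ph ps tp /= t0 ttau tautle card_le near.
set tau := _ * tp in ttau tautle card_le near *.
have pos i : [/\ 0 < g i 0, 0 < th i 0, 0 < ph i 0 & 0 < ps i 0].
  case: near => pos _; have := pos (lshift n i); have := pos (rshift n i).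
  by rewrite /ipm_v /ipm_s /= !col_mxEu !col_mxEd => -[? ?] [? ?].
have dzP := (newton_dzP tau _ lam0 Hpd pos).2 erefl.
rewrite duality_gapE /ipm_near /ipm_v /ipm_s /= -/tau.
(* From here on only the equation that [dz] solves matters. *)
move: (newton_dz lam Ht g th ph ps tau) dzP => dz dzP.
set dg := vmul (vdiv g ph) dz + _; set dth := - vmul (vdiv th ps) dz + _.
have dualE : dth - dg = (2 * lam) *: (Ht *m dz).
  move: dzP; rewrite /newton_mx !mulmxDl !mul_diag_vmul -scalemxAl.
  move=> /matrixP dzP; apply/matrixP => i j; have := dzP i j.
  by rewrite /dg /dth !mxE; lra.
have entryE (x y dx dy : 'cV[R]_n) i :
    col_mx (x + dx) (y + dy) i 0 = col_mx x y i 0 + col_mx dx dy i 0.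
  by rewrite -add_col_mx mxE.
under eq_bigr do rewrite (entryE g th dg dth) (entryE ph ps (- dz) dz).
have stepE x y dx dy := funext (entryE x y dx dy).
rewrite !stepE.
have cardE : #|'I_(n + n)|%:R = (n + n)%:R :> R by rewrite card_ord.
rewrite -cardE; apply: near_path_newton => //.
- by rewrite cardE.
- move=> i; case: (split_ordP i) => j ->; have [g0 th0 ph0 ps0] := pos j.
  + rewrite !col_mxEu !mxE mulr1; exact: newton_component.
  + rewrite !col_mxEd !mxE mulr1 -(newton_component (- dz j 0)) //.
    by rewrite opprK mulrN.
have -> : \sum_i col_mx dg dth i 0 * col_mx (- dz) dz i 0
    = ((dth - dg)^T *m dz) 0 0.
  rewrite linearB /= mulmxBl addrC -mulmxN -mul_row_col -tr_col_mx mxE.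
  by apply: eq_bigr => i _; rewrite [_^T _ _]mxE.
have [Hsym Hpos] := Hpd.
rewrite dualE linearZ /= trmx_mul Hsym -scalemxAl mxE mulr_ge0 //.
  by rewrite mulr_ge0 // ltW.
have [->|dz0] := eqVneq dz 0; first by rewrite mulmx0 mxE.
exact/ltW/Hpos.
Qed.

(** * The starting point *)

Lemma abs_entry_le_norm (R : realType) (n : nat) (x : 'cV[R]_n) (i : 'I_n) :
  `|x i 0| <= `|x|.
Proof.
rewrite [leRHS]mx_normrE.
exact: (le_bigmax _ (fun ij : 'I_n * 'I_1 => `|x ij.1 ij.2|) (i, 0)).
Qed.

(** With [S = sqrt (1 - x) + sqrt (1 + x)] and [y = sqrt (1 - x^2)] the left side
is [4 - 2 S], where [S^2 = 2 + 2 y], and the hypothesis reads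
[N (1 - y^2) <= y^2].  It remains to see [2 y^2 (4 - 2 S) <= 1 - y^2], which
after removal of the factor [2 - S] is a polynomial inequality in [S <= 2].
The constant is sharp to first order: as [x] tends to 0, [4 - 2 S] behaves like
[x^2 / 2]. *)
Lemma sqrt_pair_deviation (R : realType) (N x : R) :
  0 < N -> (N + 1) * x ^+ 2 <= 1 ->
  (1 - Num.sqrt (1 - x)) ^+ 2 + (1 - Num.sqrt (1 + x)) ^+ 2 <= (2 * N)^-1.
Proof.
move=> N0 Nx.
have x2 : x ^+ 2 < 1 by have := sqr_ge0 x; nra.
have [xlo xhi] : -1 < x /\ x < 1 by split; nra.
have a0 := sqrtr_ge0 (1 - x); have b0 := sqrtr_ge0 (1 + x).
have a2 : Num.sqrt (1 - x) ^+ 2 = 1 - x by rewrite sqr_sqrtr //; lra.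
have b2 : Num.sqrt (1 + x) ^+ 2 = 1 + x by rewrite sqr_sqrtr //; lra.
set a := Num.sqrt _ in a0 a2 *; set b := Num.sqrt _ in b0 b2 *.
pose y := a * b; pose S := a + b.
have y0 : 0 <= y by rewrite mulr_ge0.
have S0 : 0 <= S by rewrite addr_ge0.
have y2 : y ^+ 2 = 1 - x ^+ 2 by rewrite exprMn a2 b2; ring.
have y1 : y <= 1 by have := sqr_ge0 x; nra.
have S2 : S ^+ 2 = 2 + 2 * y by rewrite sqrrD a2 b2 /y; ring.
have Sle : S <= 2 by nra.
have -> : (1 - a) ^+ 2 + (1 - b) ^+ 2 = 4 - 2 * S.
  by rewrite !sqrrB a2 b2 /S; ring.
have bound : 2 * y ^+ 2 * (4 - 2 * S) <= 1 - y ^+ 2.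
  have yE : y = S ^+ 2 / 2 - 1 by rewrite S2; field.
  have yy : y ^+ 2 <= y by rewrite expr2 ler_piMl.
  have cubic : 8 * (2 * y) <= (2 + S) * S ^+ 2.
    rewrite yE -subr_ge0.
    have -> : (2 + S) * S ^+ 2 - 8 * (2 * (S ^+ 2 / 2 - 1))
        = (2 - S) * (8 + S * (4 - S)) by field.
    have : 0 <= S * (4 - S) by apply: mulr_ge0; lra.
    by move=> S4S; apply: mulr_ge0; lra.
  have -> : 1 - y ^+ 2 = (2 - S) * ((2 + S) * S ^+ 2) / 4.
    by rewrite yE; field.
  have S2_ge0 : 0 <= 2 - S by lra.
  have := ler_wpM2l S2_ge0 cubic; have := ler_wpM2l S2_ge0 yy; lra.
rewrite -(ler_pM2l (x := 2 * N)) ?mulr_gt0 // mulfV ?gt_eqF ?mulr_gt0 //.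
have Ny : N * (1 - y ^+ 2) <= y ^+ 2 by rewrite y2; lra.
have yp : 0 < y ^+ 2 by rewrite y2; lra.
rewrite -(ler_pM2l yp) mulr1; apply: le_trans Ny.
by have := ler_wpM2l (ltW N0) bound; lra.
Qed.

Lemma ipm_init_near (R : realType) (n : nat) (lam tau0 : R) (ht : 'cV[R]_n) :
  (0 < n)%N -> (n%:R + 1) * lam ^+ 2 <= 1 -> (forall i, `|ht i 0| <= 1) ->
  ipm_near 1 (ipm_init lam tau0 ht).
Proof.
move=> n0 lamn ht1.
have N1 : 1 <= n%:R :> R by rewrite ler1n.
have xn i : (n%:R + 1) * (lam * ht i 0) ^+ 2 <= 1.
  have h1 : ht i 0 ^+ 2 <= 1 by rewrite -real_normK ?num_real ?expr_le1 ?normr_ge0.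
  by rewrite exprMn; have := ler_wpM2l (sqr_ge0 lam) h1; nra.
have xb i : -1 < lam * ht i 0 /\ lam * ht i 0 < 1.
  by have := xn i; set x := lam * _ => xx; split; nra.
split=> [i|].
  rewrite /ipm_v /ipm_s /=; case: (split_ordP i) => j ->; have := xb j.
    by rewrite !col_mxEu !mxE; lra.
  by rewrite !col_mxEd !mxE; lra.
rewrite big_split_ord /= -big_split /=.
apply: (@le_trans _ _ (\sum_(i < n) (2 * n%:R)^-1)).
  apply: ler_sum => i _; rewrite /ipm_v /ipm_s /= !col_mxEu !col_mxEd !mxE !mulr1.
  by apply: sqrt_pair_deviation => //; rewrite ltr0n.
rewrite sumr_const card_ord -mulr_natl expr1n le_eqVlt; apply/orP; left.
by apply/eqP; field; rewrite pnatr_eq0 -lt0n.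
Qed.

Lemma duality_gap_init (R : realType) (n : nat) (lam tau0 : R)
    (ht : 'cV[R]_n) :
  duality_gap (ipm_init lam tau0 ht) = 2 * n%:R.
Proof.
rewrite duality_gapE big_split_ord /= -big_split /=.
rewrite (eq_bigr (fun=> 2)) => [|i _].
  by rewrite sumr_const card_ord mulr_natr.
by rewrite /ipm_v /ipm_s /= !col_mxEu !col_mxEd !mxE; ring.
Qed.

(** * Convergence of the iterates *)

(** As the parameter starts from [1 / rho] and is multiplied by [rho] before each
step, the step from iterate [k] to iterate [k + 1] aims at [rho^k]. *)
Lemma ipm_iterate_near (R : realType) (n : nat) (H : 'M[R]_n) (h : 'cV[R]_n)
    (eta lam rho : R) :
  (0 < n)%N -> sym_posdef H -> h != 0 ->
  0 < lam -> (n%:R + 1) * lam ^+ 2 <= 1 ->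
  rho = 1 - eta -> 2 / 3 <= rho -> rho <= 1 ->
  (n + n)%:R * (1 - rho) ^+ 2 <= rho ^+ 2 / 4 ->
  forall k,
  let st := ipm_iterate H h eta rho^-1 lam in
  [/\ (1 - eta) * ipm_tau (st k) = rho ^+ k,
      ipm_near (rho ^+ k) (st k) &
      duality_gap (st k.+1) <= (n + n)%:R * (rho ^+ 2) ^+ k].
Proof.
move=> n0 [Hsym Hpos] h0 lam0 lamn rhoE rho23 rho1 card_le k st.
have norm_h : 0 < `|h| by rewrite normr_gt0.
have Htpd : sym_posdef (`|h|^-1 *: H).
  split=> [|x x0]; first by rewrite linearZ /= Hsym.
  by rewrite -scalemxAr -scalemxAl mxE mulr_gt0 ?invr_gt0 ?Hpos.
have rho0 : 0 < rho by lra.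
have step j : (1 - eta) * ipm_tau (st j) = rho ^+ j ->
    ipm_near (rho ^+ j) (st j) ->
    ipm_near (rho ^+ j.+1) (st j.+1) /\
    duality_gap (st j.+1) <= (n + n)%:R * (rho ^+ 2) ^+ j.
  move=> tauE near; rewrite exprAC -tauE /st /ipm_iterate iterS.
  have rj0 : 0 < rho ^+ j by rewrite exprn_gt0.
  apply: ipm_step_near => //; rewrite -/(ipm_iterate _ _ _ _ _ _) -/st ?tauE //.
  - by rewrite exprn_gt0.
  - by rewrite exprS ler_piMl // ltW.
  - by rewrite exprS; nra.
  have -> : rho ^+ j - rho ^+ j.+1 = (1 - rho) * rho ^+ j by rewrite exprS; ring.
  rewrite (exprS rho) !exprMn mulrA [leRHS]mulrAC.
  by rewrite ler_wpM2r // sqr_ge0.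
have main : (1 - eta) * ipm_tau (st k) = rho ^+ k /\ ipm_near (rho ^+ k) (st k).
  elim: k => [|k [tauE near]].
    split; first by rewrite -rhoE /= mulfV ?gt_eqF.
    apply: ipm_init_near => // i.
    rewrite mxE normrM gtr0_norm ?invr_gt0 // mulrC ler_pdivrMr // mul1r.
    exact: abs_entry_le_norm.
  have [near' _] := step k tauE near; split=> //.
  rewrite exprS -tauE rhoE /st /ipm_iterate iterS.
  by case: (iter k _ _).
have [tauE near] := main; split=> //.
by have [] := step k tauE near.
Qed.

Lemma sqrt_2_bounds (R : realType) : 1 < Num.sqrt 2 :> R /\ Num.sqrt 2 <= 3 / 2 :> R.
Proof.
have r0 := sqrtr_ge0 (2 : R); have r2 : Num.sqrt 2 ^+ 2 = 2 :> R by rewrite sqr_sqrtr.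
by split; nra.
Qed.

(** [- 2 ln rho] is the logarithmic decrease of [c rho^(2k)] per step. *)
Lemma geometric_le_of_ceil (R : realType) (c eps rho : R) (k : nat) :
  0 < c -> 0 < eps -> 0 < rho -> rho < 1 ->
  Num.ceil (ln (c / eps) / (- 2 * ln rho)) <= k%:Z ->
  c * (rho ^+ 2) ^+ k <= eps.
Proof.
move=> c0 eps0 rho0 rho1; rewrite ceil_le_int.
have ln_rho : ln rho < 0 by rewrite ln_lt0 ?rho0.
rewrite ler_pdivrMr; last by lra.
rewrite -pmulrn => le_k.
have p0 : 0 < (rho ^+ 2) ^+ k by rewrite !exprn_gt0.
have ce0 : 0 < c / eps by rewrite divr_gt0.
suff : c / eps * (rho ^+ 2) ^+ k <= 1.
  by rewrite mulrAC ler_pdivrMr // mul1r.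
have prod0 := mulr_gt0 ce0 p0.
rewrite -ler_ln ?posrE ?ltr01 // ln1 lnM ?posrE // -exprM lnXn //.
by rewrite -mulr_natl natrM; lra.
Qed.

Theorem theorem1 (R : realType) (n : nat) (hn : (1 <= n)%N)
    (H : 'M[R]_n) (hH : sym_posdef H)
    (h : 'cV[R]_n) (hh : h != 0)
    (eps : R) (heps : 0 < eps) :
  let sqrt2n : R := Num.sqrt (2 * n%:R) in
  let eta : R := (Num.sqrt 2 - 1) / (sqrt2n + Num.sqrt 2 - 1) in
  let tau0 : R := 1 / (1 - eta) in
  let lam : R := 1 / Num.sqrt (n%:R + 1) in
  let Nmax : int :=
    Num.ceil (ln (2 * n%:R / eps)
              / (- 2 * ln (sqrt2n / (sqrt2n + Num.sqrt 2 - 1)))) + 1 in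
  exists k : nat,
    k%:Z <= Num.max Nmax 0 /\
    ((ipm_v (ipm_iterate H h eta tau0 lam k))^T
       *m ipm_s (ipm_iterate H h eta tau0 lam k)) 0 0 <= eps.
Proof.
move=> m eta tau0 lam.
set rho := m / (m + Num.sqrt 2 - 1); set c := Num.ceil _ => Nmax.
have N1 : 1 <= n%:R :> R by rewrite ler1n.
have [c_gt1 c_le] := sqrt_2_bounds R.
have m0 : 0 <= m := sqrtr_ge0 _.
have m2 : m ^+ 2 = 2 * n%:R by rewrite sqr_sqrtr // mulr_ge0.
have m1 : 1 <= m by nra.
have mc0 : 0 < m + Num.sqrt 2 - 1 by lra.
have rhoE : rho = 1 - eta by rewrite /rho /eta; field; rewrite gt_eqF.
have rho0 : 0 < rho by rewrite divr_gt0 //; lra.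
have rho1 : rho < 1 by rewrite ltr_pdivrMr // mul1r; lra.
have rho23 : 2 / 3 <= rho by rewrite ler_pdivlMr //; lra.
have card_le : (n + n)%:R * (1 - rho) ^+ 2 <= rho ^+ 2 / 4.
  have -> : (n + n)%:R = m ^+ 2 :> R by rewrite m2 natrD; ring.
  have -> : 1 - rho = (Num.sqrt 2 - 1) / (m + Num.sqrt 2 - 1).
    by rewrite /rho; field; rewrite gt_eqF.
  (* Over the common denominator this is [(sqrt 2 - 1)^2 <= 1/4]. *)
  rewrite /rho !exprMn mulrA [leRHS]mulrAC ler_wpM2r ?sqr_ge0 //.
  by rewrite ler_wpM2l ?sqr_ge0 //; nra.
have lam0 : 0 < lam by rewrite divr_gt0 // sqrtr_gt0; lra.
have lamn : (n%:R + 1) * lam ^+ 2 <= 1.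
  by rewrite exprMn expr1n mul1r exprVn sqr_sqrtr ?mulfV ?gt_eqF //; lra.
have -> : tau0 = rho^-1 by rewrite /tau0 -rhoE mul1r.
have iterates := ipm_iterate_near hn hH hh lam0 lamn rhoE rho23 (ltW rho1) card_le.
have [c_ge0|c_lt0] := leP 0 c; last first.
  (* [c <= 0] makes the bound for [k = 0] say that [2n <= eps]. *)
  exists 0%N; split; first by rewrite le_max lexx orbT.
  rewrite -/(duality_gap _) duality_gap_init.
  have := @geometric_le_of_ceil _ (2 * n%:R) eps rho 0.
  rewrite expr0 mulr1; apply=> //; last exact: ltW.
  by rewrite mulr_gt0 //; lra.
have [k cE] : exists k : nat, c = k%:Z by exists `|c|%N; rewrite gez0_abs.
exists k.+1; split; first by rewrite le_max /Nmax cE -addn1 lexx.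
have [_ _ gap] := iterates k.
rewrite -/(duality_gap _); apply: le_trans gap _.
have -> : (n + n)%:R = 2 * n%:R :> R by rewrite natrD; ring.
apply: geometric_le_of_ceil => //; first by rewrite mulr_gt0 //; lra.
by rewrite -/c cE.
Qed.
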